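(* Let $A$ be a regular ring containing a field of characteristic zero, let $m\ge 1$, and let $R=A[X_1,\ldots,X_m]$ be graded by $\deg A=0$ and $\deg X_i=1$ for all $i$. Let $I$ be a homogeneous ideal of $R$, let $i\ge 0$, and let $M=H^i_I(R)=\bigoplus_{n\in\mathbb{Z}}M_n$. Then: (a) The following are equivalent: (i) $M_n\neq 0$ for infinitely many $n\ll 0$ (that is, for infinitely many negative integers $n$); (ii) $M_n\ne 0$ for all $n\le -m$. (b) The following are equivalent: (i) $M_n\neq 0$ for infinitely many $n\gg 0$ (that is, for infinitely many positive integers $n$); (ii) $M_n\neq 0$ for all $n\ge 0$.
   Context: Regular rings are commutative and Noetherian. $H^i_I(R)$ denotes the $i$-th local cohomology module of $R$ with support in $I$; it is a graded $R$-module, and $M_n$ is its degree $n$ component, which is an $A$-module. *)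

(* Defs.v *)
From HB Require Import structures.
From mathcomp Require Import all_boot all_order all_algebra.
From mathcomp Require Export mpoly.

Set Implicit Arguments.
Unset Strict Implicit.
Unset Printing Implicit Defensive.

Import GRing.Theory.

Local Open Scope ring_scope.

(* Ideals are Prop-valued predicates: membership in an ideal of an arbitrary   *)
(* commutative ring is not decidable.                                          *)
Section CommutativeAlgebra.
Variable B : comNzRingType.
Implicit Types (I J P : B -> Prop).

Definition is_ideal I : Prop :=
  [/\ I 0,
      forall x y, I x -> I y -> I (x + y)
    & forall a x, I x -> I (a * x)].

Definition is_prime_ideal P : Prop :=
  [/\ is_ideal P, ~ P 1 & forall x y, P (x * y) -> P x \/ P y].

Definition is_maximal_ideal P : Prop :=
  [/\ is_ideal P, ~ P 1
    & forall J, is_ideal J -> ~ J 1 ->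
        (forall x, P x -> J x) -> forall x, J x -> P x].

Definition ideal_gen (s : seq B) : B -> Prop :=
  fun x => exists c : 'I_(size s) -> B, x = \sum_(j < size s) c j * s`_j.

Definition noetherian : Prop :=
  forall I, is_ideal I -> exists s : seq B, forall x, I x <-> ideal_gen s x.

Definition is_prime_chain (C : nat -> B -> Prop) (d : nat) : Prop :=
  (forall k, (k <= d)%N -> is_prime_ideal (C k)) /\
  (forall k, (k < d)%N ->
     (forall x, C k x -> C k.+1 x) /\ (exists x, C k.+1 x /\ ~ C k x)).

Definition krull_dim_eq (d : nat) : Prop :=
  (exists C, is_prime_chain C d) /\
  (forall C e, is_prime_chain C e -> (e <= d)%N).

Definition regular_local : Prop :=
  noetherian /\
  exists mm : B -> Prop,
    [/\ is_maximal_ideal mm,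
        forall J, is_maximal_ideal J -> forall x, J x <-> mm x
      & exists s : seq B,
          krull_dim_eq (size s) /\ (forall x, mm x <-> ideal_gen s x)].

Fixpoint ideal_pow I (k : nat) : B -> Prop :=
  if k is k'.+1 then
    fun x => exists s : seq (B * B),
      (forall u, u \in s -> I u.1 /\ ideal_pow I k' u.2) /\
      x = \sum_(u <- s) u.1 * u.2
  else fun=> True.

End CommutativeAlgebra.

(* phi exhibits B as the localization of A at the prime ideal P; this          *)
(* determines B up to a unique isomorphism of A-algebras.                      *)
Definition is_localization_at (A B : comNzRingType) (P : A -> Prop)
    (phi : {rmorphism A -> B}) : Prop :=
  [/\ forall s, ~ P s -> exists u, u * phi s = 1,
      forall b, exists a s, ~ P s /\ b * phi s = phi a
    & forall a, phi a = 0 -> exists s, ~ P s /\ s * a = 0].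

Definition regular_ring (A : comNzRingType) : Prop :=
  noetherian A /\
  forall P : A -> Prop, is_prime_ideal P ->
    exists (B : comNzRingType) (phi : {rmorphism A -> B}),
      is_localization_at P phi /\ regular_local B.

Definition contains_field_char0 (A : comNzRingType) : Prop :=
  exists (K : fieldType) (f : {rmorphism K -> A}),
    [pchar K] =i pred0 /\ injective f.

Definition infinitely_many (P : int -> Prop) : Prop :=
  forall s : seq int, exists n : int, n \notin s /\ P n.

Section GradedModules.
Variables (A : comNzRingType) (m : nat).
Local Notation R := {mpoly A[m]}.

Definition poly_deg (n : int) (p : R) : Prop :=
  if n is Posz k then p \is k.-homog else p = 0.

Definition homogeneous_ideal (I : R -> Prop) : Prop :=
  is_ideal I /\ forall p k, I p -> I (pihomog mdeg k p).

(* Z-graded R-modules, with the module as an internal direct sum of its        *)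
(* homogeneous components.                                                     *)
Record grmod := GrMod {
  gr_mod :> lmodType R;
  gr_deg : int -> gr_mod -> Prop;
  gr_deg0 : forall n, gr_deg n 0;
  gr_degB : forall n x y, gr_deg n x -> gr_deg n y -> gr_deg n (x - y);
  gr_degZ : forall k n a x,
    poly_deg k a -> gr_deg n x -> gr_deg (k + n) (a *: x);
  gr_span : forall x, exists (s : seq int) (f : int -> gr_mod),
    [/\ uniq s, forall n, gr_deg n (f n) & x = \sum_(n <- s) f n];
  gr_indep : forall (s : seq int) (f : int -> gr_mod),
    uniq s -> (forall n, gr_deg n (f n)) -> \sum_(n <- s) f n = 0 ->
    forall n, n \in s -> f n = 0
}.

Definition component_nonzero (M : grmod) (n : int) : Prop :=
  exists x : M, gr_deg n x /\ x <> 0.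

Definition is_graded_hom (M N : grmod) (f : {linear M -> N}) : Prop :=
  forall n x, gr_deg n x -> gr_deg n (f x).

Definition graded_injective (E : grmod) : Prop :=
  forall (N N' : grmod) (j : {linear N -> N'}) (f : {linear N -> E}),
    is_graded_hom j -> injective j -> is_graded_hom f ->
    exists g : {linear N' -> E}, is_graded_hom g /\ forall x, g (j x) = f x.

Record graded_injective_resolution (N : grmod) := GrInjRes {
  ir_obj :> nat -> grmod;
  ir_aug : {linear N -> ir_obj 0};
  ir_d : forall k, {linear ir_obj k -> ir_obj k.+1};
  ir_injective : forall k, graded_injective (ir_obj k);
  ir_aug_graded : is_graded_hom ir_aug;
  ir_d_graded : forall k, is_graded_hom (ir_d k);
  ir_aug_inj : injective ir_aug;
  ir_exact0 : forall x, ir_d 0 x = 0 <-> exists y, ir_aug y = x;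
  ir_exact : forall k x, ir_d k.+1 x = 0 <-> exists y, ir_d k y = x
}.

Section LocalCohomology.
Variable I : R -> Prop.

Definition in_torsion (M : grmod) (x : M) : Prop :=
  exists k : nat, forall a, ideal_pow I k a -> a *: x = 0.

Variables (N : grmod) (E : graded_injective_resolution N).

Definition is_cocycle (i : nat) (x : E i) : Prop :=
  in_torsion x /\ ir_d E i x = 0.

Definition is_coboundary (i : nat) : E i -> Prop :=
  if i is j.+1 then fun x => exists y : E j, in_torsion y /\ ir_d E j y = x
  else fun x => x = 0.

End LocalCohomology.

(* The graded module M is (a model of) H^i_I(N): the i-th right derived        *)
(* functor of the I-torsion functor Gamma_I, computed from an injective        *)
(* resolution E of N in the category of graded R-modules, which is where the   *)
(* grading of local cohomology comes from. Here Z is the module of             *)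
(* i-cocycles of Gamma_I(E), embedded by iota, and pi identifies M with the    *)
(* quotient of Z by the coboundaries, compatibly with the gradings.            *)
Definition is_local_cohomology (I : R -> Prop) (i : nat) (N M : grmod) : Prop :=
  exists (E : graded_injective_resolution N)
         (Z : grmod) (iota : {linear Z -> E i}) (pi : {linear Z -> M}),
    [/\ is_graded_hom iota /\ injective iota,
        forall x, is_cocycle I x <-> exists z, iota z = x,
        is_graded_hom pi,
        forall y, exists z, pi z = y
      & forall z, pi z = 0 <-> is_coboundary I (iota z)].

Fact poly_deg0 n : poly_deg n 0.
Proof. by case: n => k //=; rewrite dhomog0. Qed.

Fact poly_degB n p q : poly_deg n p -> poly_deg n q -> poly_deg n (p - q).
Proof. by case: n => k /=; [exact: rpredB | move=> -> ->; rewrite subr0]. Qed.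

Fact poly_degZ k n (a : R) (p : R^o) :
  poly_deg k a -> poly_deg n p -> poly_deg (k + n) (a *: p).
Proof.
case: k => k /=; last by move=> -> _; rewrite scale0r; exact: poly_deg0.
case: n => n /=; last by move=> _ ->; rewrite scaler0; exact: poly_deg0.
exact: dhomogM.
Qed.

Fact poly_span (p : R^o) : exists (s : seq int) (f : int -> R^o),
  [/\ uniq s, forall n, poly_deg n (f n) & p = \sum_(n <- s) f n].
Proof.
exists [seq Posz k | k <- iota 0 (msize p)].
exists (fun n => if n is Posz k then pihomog mdeg k p else 0); split.
- by rewrite map_inj_uniq ?iota_uniq // => a b [].
- by case=> k //=; exact: pihomogP.
- rewrite big_map -[in iota _ _](subn0 (msize p)) -/(index_iota _ _) big_mkord.
  exact: pihomog_partitionE.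
Qed.

Fact poly_indep (s : seq int) (f : int -> R^o) :
  uniq s -> (forall n, poly_deg n (f n)) -> \sum_(n <- s) f n = 0 ->
  forall n, n \in s -> f n = 0.
Proof.
move=> us hf sum0 [k|k] ks; last exact: (hf (Negz k)).
have /(congr1 (pihomog mdeg k)) := sum0.
rewrite raddf_sum pihomog0 (bigD1_seq (Posz k)) //= (pihomog_dE (hf (Posz k))).
rewrite big1 ?addr0 // => -[l|l] lk; last by rewrite (hf (Negz l)) pihomog0.
by apply: (pihomog_ne0 _ (hf (Posz l))); apply: contraNneq lk => ->.
Qed.

Definition poly_grmod : grmod :=
  @GrMod R^o poly_deg poly_deg0 poly_degB poly_degZ poly_span poly_indep.

End GradedModules.

(* Main.v *)
Require Import Defs.
From HB Require Import structures.
From mathcomp Require Import all_boot all_order all_algebra.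
From Stdlib Require Import ClassicalEpsilon.

Set Implicit Arguments.
Unset Strict Implicit.
Unset Printing Implicit Defensive.

Import Order.TTheory GRing.Theory Num.Theory.

Local Open Scope ring_scope.

(** Put n for the degree and write d_j for the partial derivative in X_j. The
    point is that every H^i_I(R) carries operators d_j, of degree -1 and
    satisfying the Leibniz rule over the partial derivatives of R, for which
    Euler's formula holds: sum_j X_j d_j acts on the degree n component M_n as
    multiplication by n. By Leibniz, sum_j d_j X_j then acts as n + m. So if
    M_n = 0 and z lies in M_(n+1), then each d_j z vanishes and (n + 1) z = 0;
    if M_n = 0 and z lies in M_(n-1), then each X_j z vanishes and
    (n - 1 + m) z = 0. Nonzero integers being invertible in A, a zero component in degree
    n >= 0 forces all higher components to vanish, and a zero component in
    degree n <= -m forces all lower ones to vanish ([component_vanishing]).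

    The operators d_j are built on a graded injective resolution E of R, which
    gives the local cohomology its grading. A graded injective module carries a
    connection over each partial derivative: such a connection is a retraction
    of the inclusion y |-> (0, y) into a module M (+) M whose scalar
    multiplication is twisted by the derivative ([connection_exists]).
    Two connections differ by a linear map, so injectivity also
    allows them to be corrected until they commute with the differentials
    ([connection_extend]). They preserve I-torsion, because a derivation maps
    I^(k+1) into I^k, and hence act on cohomology.

    For Euler's formula, let theta be sum_j X_j d_j minus the operator that
    multiplies by the degree. Both terms obey the Leibniz rule over the Euler
    derivation of R, so theta is linear. It is a chain map of E extending the
    zero map of R, by Euler's formula for polynomials, so it is
    homotopic to zero through linear maps. These preserve torsion, and therefore
    theta vanishes on local cohomology ([euler_structure_exists]). *)

(** * Homogeneous components and the degree operator *)

Section Components.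
Variables (A : comNzRingType) (m : nat).
Local Notation R := {mpoly A[m]}.
Implicit Types M N : grmod A m.

Lemma gr_degN M n (x : M) : gr_deg n x -> gr_deg n (- x).
Proof. by move=> hx; rewrite -sub0r; apply: gr_degB => //; apply: gr_deg0. Qed.

Lemma gr_degD M n (x y : M) : gr_deg n x -> gr_deg n y -> gr_deg n (x + y).
Proof. by move=> hx hy; rewrite -[y]opprK; apply: gr_degB => //; apply: gr_degN. Qed.

Lemma gr_deg_sum M n (T : Type) (s : seq T) (P : pred T) (F : T -> M) :
  (forall t, P t -> gr_deg n (F t)) -> gr_deg n (\sum_(t <- s | P t) F t).
Proof.
by move=> h; elim/big_ind: _ => //; [apply: gr_deg0 | move=> *; apply: gr_degD].
Qed.

Lemma gr_degMz M n (x : M) (k : int) : gr_deg n x -> gr_deg n (x *~ k).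
Proof.
have degMn (i : nat) : gr_deg n x -> gr_deg n (x *+ i).
  move=> hx; elim: i => [|i IH]; first exact: gr_deg0.
  by rewrite mulrS; apply: gr_degD.
by move=> hx; case: k => i; rewrite ?NegzE ?mulrNz; [|apply: gr_degN];
  exact: degMn.
Qed.

Lemma decomposition_exists M (x : M) : exists sc : seq int * (int -> M),
  [/\ uniq sc.1, forall n, gr_deg n (sc.2 n), forall n, n \notin sc.1 -> sc.2 n = 0
    & x = \sum_(n <- sc.1) sc.2 n].
Proof.
have [s [f [us hf ->]]] := gr_span x.
exists (s, fun n => if n \in s then f n else 0); split => //=.
- by move=> n; case: ifP => // _; apply: gr_deg0.
- by move=> n /negbTE ->.
- by apply: eq_big_seq => n ->.
Qed.

Definition decomposition M (x : M) :=
  proj1_sig (constructive_indefinite_description _ (decomposition_exists x)).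
Definition support_degrees M (x : M) := (decomposition x).1.
Definition component M (n : int) (x : M) := (decomposition x).2 n.

Lemma support_degrees_uniq M (x : M) : uniq (support_degrees x).
Proof.
by rewrite /support_degrees /decomposition;
  case: constructive_indefinite_description => ? [].
Qed.

Lemma component_deg M n (x : M) : gr_deg n (component n x).
Proof.
by rewrite /component /decomposition;
  case: constructive_indefinite_description => ? [].
Qed.

Lemma component_out M n (x : M) : n \notin support_degrees x -> component n x = 0.
Proof.
rewrite /support_degrees /component /decomposition.
by case: constructive_indefinite_description => ? [] /= _ _ + _; apply.
Qed.

Lemma sum_component M (x : M) : \sum_(n <- support_degrees x) component n x = x.
Proof.
by rewrite /support_degrees /component /decomposition;
  case: constructive_indefinite_description => ? [].
Qed.

(** Sums over supports of different elements become comparable once they are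
    taken over a common larger index set. *)
Lemma big_support (V : nmodType) (s t : seq int) (F : int -> V) :
  uniq s -> uniq t -> {subset s <= t} -> (forall n, n \notin s -> F n = 0) ->
  \sum_(n <- t) F n = \sum_(n <- s) F n.
Proof.
move=> us ut st F0; rewrite (bigID (mem s)) /= [X in _ + X]big1 ?addr0; last first.
  by move=> n /F0.
rewrite -big_filter; apply: perm_big; apply: uniq_perm; rewrite ?filter_uniq //.
by move=> n; rewrite mem_filter; case: (boolP (n \in s)) => //= /st ->.
Qed.

(** Uniqueness of the decomposition: components are computed by exhibiting a
    candidate family of homogeneous elements. *)
Lemma component_unique M (x : M) (s : seq int) (f : int -> M) n :
  uniq s -> (forall k, gr_deg k (f k)) -> (forall k, k \notin s -> f k = 0) ->
  x = \sum_(k <- s) f k -> component n x = f n.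
Proof.
move=> us hf f0 xE; set t := undup (n :: s ++ support_degrees x).
have ut : uniq t by apply: undup_uniq.
apply/eqP; rewrite -subr_eq0; apply/eqP.
apply: (@gr_indep _ _ M t (fun k => component k x - f k)); rewrite ?mem_undup ?mem_head //.
  by move=> k; apply: gr_degB => //; apply: component_deg.
rewrite sumrB.
have -> : \sum_(k <- t) f k = x.
  by rewrite xE; apply: big_support => // k hk; rewrite mem_undup inE mem_cat hk orbT.
rewrite -[X in _ - X](sum_component x); apply/eqP; rewrite subr_eq0; apply/eqP.
apply: big_support => //; first exact: support_degrees_uniq.
  by move=> k hk; rewrite mem_undup inE mem_cat hk !orbT.
by move=> k /component_out.
Qed.

Lemma component_homog M n (x : M) k :
  gr_deg n x -> component k x = if k == n then x else 0.
Proof.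
move=> hx; apply: (@component_unique _ _ [:: n] (fun k => if k == n then x else 0)) => //.
- by move=> l; case: eqP => [->|_] //; apply: gr_deg0.
- by move=> l; rewrite inE => /negbTE ->.
- by rewrite big_seq1 eqxx.
Qed.

Lemma componentB M n (x y : M) :
  component n (x - y) = component n x - component n y.
Proof.
set t := undup (support_degrees x ++ support_degrees y).
have ut : uniq t by apply: undup_uniq.
apply: (@component_unique _ _ t (fun k => component k x - component k y)) => //.
- by move=> k; apply: gr_degB; apply: component_deg.
- move=> k; rewrite mem_undup mem_cat negb_or => /andP[hx hy].
  by rewrite !component_out // subrr.
- rewrite sumrB -[in LHS](sum_component x) -[in LHS](sum_component y).
  congr (_ - _); symmetry; apply: big_support => //; try exact: support_degrees_uniq;
    try by move=> k /component_out.
  all: by move=> k hk; rewrite mem_undup mem_cat hk ?orbT.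
Qed.

Lemma component_hom M N (f : {linear M -> N}) n (x : M) :
  is_graded_hom f -> f (component n x) = component n (f x).
Proof.
move=> hf; symmetry.
apply: (@component_unique _ _ (support_degrees x) (fun k => f (component k x))).
- exact: support_degrees_uniq.
- by move=> k; apply/hf/component_deg.
- by move=> k /component_out ->; rewrite raddf0.
- by rewrite -raddf_sum sum_component.
Qed.

Definition degree_op M (x : M) : M :=
  \sum_(n <- support_degrees x) component n x *~ n.

Lemma degree_op_sum M (x : M) (t : seq int) :
  uniq t -> {subset support_degrees x <= t} ->
  degree_op x = \sum_(n <- t) component n x *~ n.
Proof.
move=> ut st; symmetry; apply: big_support => //; first exact: support_degrees_uniq.
by move=> n /component_out ->; rewrite mul0rz.
Qed.

Lemma degree_op_homog M n (x : M) : gr_deg n x -> degree_op x = x *~ n.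
Proof.
move=> hx; rewrite (@degree_op_sum _ _ (undup (n :: support_degrees x))) ?undup_uniq //;
  last by move=> k hk; rewrite mem_undup inE hk orbT.
rewrite (bigD1_seq n) ?undup_uniq ?mem_undup ?mem_head //=.
rewrite (component_homog _ hx) eqxx big1 ?addr0 // => k /negbTE kn.
by rewrite (component_homog _ hx) kn mul0rz.
Qed.

Lemma degree_opB M (x y : M) : degree_op (x - y) = degree_op x - degree_op y.
Proof.
set t := undup (support_degrees x ++ support_degrees y ++ support_degrees (x - y)).
have ut : uniq t by apply: undup_uniq.
rewrite !(@degree_op_sum _ _ t) //; try by move=> k hk; rewrite mem_undup !mem_cat hk ?orbT.
by rewrite -sumrB; apply: eq_bigr => k _; rewrite componentB mulrzBl.
Qed.

Lemma degree_opD M (x y : M) : degree_op (x + y) = degree_op x + degree_op y.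
Proof.
have degree_op0 : degree_op (0 : M) = 0 by rewrite -[in LHS](subrr 0) degree_opB subrr.
have degree_opN (z : M) : degree_op (- z) = - degree_op z.
  by rewrite -sub0r degree_opB degree_op0 sub0r.
by rewrite -[y in LHS]opprK degree_opB degree_opN opprK.
Qed.

Lemma degree_op_hom M N (f : {linear M -> N}) (x : M) :
  is_graded_hom f -> degree_op (f x) = f (degree_op x).
Proof.
move=> hf; set t := undup (support_degrees x ++ support_degrees (f x)).
have ut : uniq t by apply: undup_uniq.
rewrite !(@degree_op_sum _ _ t) //; try by move=> k hk; rewrite mem_undup !mem_cat hk ?orbT.
by rewrite raddf_sum; apply: eq_bigr => k _; rewrite raddfMz -component_hom.
Qed.

Lemma eq_on_homogeneous M (V : zmodType) (f g : M -> V) :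
  {morph f : x y / x + y} -> {morph g : x y / x + y} ->
  (forall n x, gr_deg n x -> f x = g x) -> f =1 g.
Proof.
move=> fD gD h x; rewrite -(sum_component x).
elim: (support_degrees x) => [|n s IH].
  by rewrite !big_nil; apply: (h 0); apply: gr_deg0.
by rewrite !big_cons fD gD IH; congr (_ + _); apply/h/component_deg.
Qed.

(** Graded maps commute with the projections onto components, so the degree n
    component of any preimage is again a preimage. *)
Lemma homogeneous_lift M N (f : {linear M -> N}) n (x : M) :
  is_graded_hom f -> gr_deg n (f x) -> exists2 z, gr_deg n z & f z = f x.
Proof.
move=> hf hx; exists (component n x); first exact: component_deg.
by rewrite component_hom // (component_homog _ hx) eqxx.
Qed.

Lemma poly_degX (j : 'I_m) : poly_deg 1 ('X_j : R).
Proof. by rewrite /= dhomogX /= mdeg1. Qed.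

Lemma gr_degXl M n (j : 'I_m) (x : M) :
  gr_deg n x -> gr_deg (n + 1) ('X_j *: x).
Proof. by move=> hx; rewrite addrC; apply: gr_degZ => //; apply: poly_degX. Qed.

(** A derivative of a constant is 0, which is why degree -1 causes no exception:
    there [poly_deg] holds of 0 only. *)
Lemma poly_deg_mderiv n (j : 'I_m) (p : R) :
  poly_deg n p -> poly_deg (n - 1) (mderiv j p).
Proof.
case: n => n hp; last by rewrite (hp : p = 0) mderiv0; exact: poly_deg0.
have {}hp : p \is n.-homog := hp; rewrite [p]mpolyE raddf_sum big_seq.
elim/big_ind: _ => [|x y hx hy|u hu]; first exact: poly_deg0.
  rewrite -[y]opprK -[- y]sub0r; apply: poly_degB => //.
  by apply: poly_degB => //; apply: poly_deg0.
have du : mdeg u = n := dhomog_mf hp hu.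
rewrite /= mderivZ mderivX.
case: (posnP (u j)) => [->|uj0]; first by rewrite scale0r scaler0; exact: poly_deg0.
have n0 : (0 < n)%N by rewrite -du; move: uj0; rewrite (mdegE u) (bigD1 j) //=; case: (u j).
have -> : n%:Z - 1 = n.-1%:Z by rewrite predn_int.
rewrite /=; apply: dhomogZ; apply: dhomogZ; rewrite dhomogX /=; apply/eqP.
have /(congr1 mdeg) : u = ((u - U_(j)) + U_(j))%MM.
  by rewrite submK // lep1mP -lt0n.
by rewrite mdegD mdeg1 du addn1 => ->.
Qed.

Lemma euler_formula n (p : R) :
  poly_deg n p -> \sum_(j < m) 'X_j * mderiv j p = p *~ n.
Proof.
case: n => n /=; last by move=> ->; rewrite mul0rz big1 // => j _; rewrite mderiv0 mulr0.
move=> hp; rewrite -pmulrn [p in RHS]mpolyE.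
transitivity (\sum_(j < m) \sum_(u <- msupp p) 'X_j * (p@_u *: mderiv j 'X_[u])).
  apply: eq_bigr => j _; rewrite -mulr_sumr; congr (_ * _).
  rewrite {1}[p]mpolyE raddf_sum.
  by apply: eq_bigr => u _; rewrite /= mderivZ.
rewrite exchange_big -sumrMnl big_seq [RHS]big_seq; apply: eq_bigr => u hu.
rewrite -(dhomog_mf hp hu : mdeg u = n) mdegE -sumrMnr; apply: eq_bigr => j _.
rewrite mderivX -scalerAr -scalerAr scaler_nat -mpolyXD.
case: (posnP (u j)) => [->|uj0]; first by rewrite !mulr0n scaler0.
by rewrite addmC submK ?lep1mP -?lt0n // scalerMnr.
Qed.

End Components.

(** * Shifted modules, images and extension of maps *)

Section Shift.
Variables (A : comNzRingType) (m : nat) (M : grmod A m) (s : int).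

Let shift_deg (n : int) (x : M) : Prop := gr_deg (n - s) x.

Fact shift_deg0 n : shift_deg n 0. Proof. exact: gr_deg0. Qed.
Fact shift_degB n x y : shift_deg n x -> shift_deg n y -> shift_deg n (x - y).
Proof. exact: gr_degB. Qed.
Fact shift_degZ k n a x :
  poly_deg k a -> shift_deg n x -> shift_deg (k + n) (a *: x).
Proof. by move=> ha hx; rewrite /shift_deg -addrA; apply: gr_degZ. Qed.
Fact shift_span x : exists (t : seq int) (f : int -> M),
  [/\ uniq t, forall n, shift_deg n (f n) & x = \sum_(n <- t) f n].
Proof.
have [t [f [ut hf ->]]] := gr_span x.
exists [seq n + s | n <- t], (fun n => f (n - s)); split.
- by rewrite map_inj_uniq //; apply: addIr.
- by move=> n; apply: hf.
- by rewrite big_map; apply: eq_bigr => n _; rewrite addrK.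
Qed.
Fact shift_indep (t : seq int) (f : int -> M) :
  uniq t -> (forall n, shift_deg n (f n)) -> \sum_(n <- t) f n = 0 ->
  forall n, n \in t -> f n = 0.
Proof.
move=> ut hf f0 n nt; rewrite -(subrK s n).
apply: (@gr_indep _ _ M [seq k - s | k <- t] (fun k => f (k + s))).
- by rewrite map_inj_uniq //; apply: addIr.
- by move=> k; have := hf (k + s); rewrite /shift_deg addrK.
- by rewrite big_map -[RHS]f0; apply: eq_bigr => k _; rewrite subrK.
- by apply/mapP; exists n.
Qed.

Definition shift : grmod A m :=
  @GrMod A m M shift_deg shift_deg0 shift_degB shift_degZ shift_span shift_indep.

End Shift.

Section Image.
Variables (A : comNzRingType) (m : nat) (M N : grmod A m) (d : {linear M -> N}).
Local Notation R := {mpoly A[m]}.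

(** The excluded middle turns the existence of a preimage into the boolean
    predicate that a subtype needs. *)
Definition in_image : {pred N} := fun y =>
  if excluded_middle_informative (exists x, d x = y) then true else false.

Lemma in_imageP y : reflect (exists x, d x = y) (y \in in_image).
Proof.
by rewrite unfold_in /in_image; case: excluded_middle_informative => h; constructor.
Qed.

Fact in_image_submod : submod_closed in_image.
Proof.
split; first by apply/in_imageP; exists 0; rewrite raddf0.
move=> a _ _ /in_imageP[x <-] /in_imageP[y <-]; apply/in_imageP.
by exists (a *: x + y); rewrite linearP.
Qed.

HB.instance Definition _ := GRing.isSubmodClosed.Build R N in_image in_image_submod.

Record image := Image { image_val : N; image_valP : image_val \in in_image }.
HB.instance Definition _ := [isSub for image_val].
HB.instance Definition _ := [Choice of image by <:].
HB.instance Definition _ := [SubChoice_isSubLmodule of image by <:].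

Hypothesis d_graded : is_graded_hom d.

Let image_deg (n : int) (y : image) : Prop := gr_deg n (val y).

Fact image_deg0 n : image_deg n 0.
Proof. by rewrite /image_deg raddf0; apply: gr_deg0. Qed.
Fact image_degB n x y : image_deg n x -> image_deg n y -> image_deg n (x - y).
Proof. by rewrite /image_deg raddfB; apply: gr_degB. Qed.
Fact image_degZ k n a x :
  poly_deg k a -> image_deg n x -> image_deg (k + n) (a *: x).
Proof. by rewrite /image_deg linearZ; apply: gr_degZ. Qed.
Fact image_span (x : image) : exists (t : seq int) (f : int -> image),
  [/\ uniq t, forall n, image_deg n (f n) & x = \sum_(n <- t) f n].
Proof.
have /in_imageP[y yE] := image_valP x.
have im n : d (component n y) \in in_image.
  by apply/in_imageP; exists (component n y).
exists (support_degrees y), (fun n => Image (im n)); split.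
- exact: support_degrees_uniq.
- by move=> n; apply/d_graded/component_deg.
- apply: val_inj; rewrite raddf_sum /= -yE -{1}(sum_component y) raddf_sum.
  exact: eq_bigr.
Qed.
Fact image_indep (t : seq int) (f : int -> image) :
  uniq t -> (forall n, image_deg n (f n)) -> \sum_(n <- t) f n = 0 ->
  forall n, n \in t -> f n = 0.
Proof.
move=> ut hf /(congr1 val); rewrite raddf_sum raddf0 => f0 n nt.
by apply: val_inj; rewrite raddf0; apply: (gr_indep ut hf f0 nt).
Qed.

Definition image_grmod : grmod A m :=
  @GrMod A m image image_deg image_deg0 image_degB image_degZ image_span image_indep.

Definition image_incl : image_grmod -> N := val.

Lemma image_incl_linear : linear image_incl.
Proof. exact: linearP. Qed.

HB.instance Definition _ :=
  GRing.isLinear.Build R image_grmod N _ image_incl image_incl_linear.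

End Image.

Section Extension.
Variables (A : comNzRingType) (m : nat).
Local Notation R := {mpoly A[m]}.

(** The universal property of injectives in the form used on resolutions: a map
    killing the kernel of [d] factors through the image of [d], and extends from
    there. Maps of degree [s] are degree 0 maps out of a shifted module. *)
Lemma extend_along (M N E : grmod A m) (d : {linear M -> N}) (f : {linear M -> E}) s :
  graded_injective E -> is_graded_hom d ->
  (forall n x, gr_deg n x -> gr_deg (n + s) (f x)) ->
  (forall x, d x = 0 -> f x = 0) ->
  exists g : {linear N -> E},
    (forall n y, gr_deg n y -> gr_deg (n + s) (g y)) /\ forall x, g (d x) = f x.
Proof.
move=> injE hd hf ker.
(* An arbitrary preimage suffices: f takes the same value on all of them. *)
pose pre (y : image d) : M :=
  proj1_sig (constructive_indefinite_description _ (in_imageP d _ (image_valP y))).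
have preE y : d (pre y) = val y by rewrite /pre; case: constructive_indefinite_description.
have fE x y : d x = d y -> f x = f y.
  move=> dxy; apply/subr0_eq; rewrite -raddfB; apply: ker; apply/eqP.
  by rewrite linearB subr_eq0; apply/eqP.
have fbar_linear : linear (f \o pre : shift (image_grmod hd) s -> E).
  by move=> a x y /=; rewrite -linearP; apply: fE; rewrite linearP !preE linearP.
pose fbar : {linear shift (image_grmod hd) s -> E} :=
  HB.pack (f \o pre : shift (image_grmod hd) s -> E)
    (GRing.isLinear.Build _ _ _ _ _ fbar_linear).
pose incl : {linear shift (image_grmod hd) s -> shift N s} := @image_incl _ _ _ _ _ hd.
have [g [hg gE]] : exists g : {linear shift N s -> E},
  is_graded_hom g /\ forall y, g (incl y) = fbar y.
  apply: injE => //.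
  - exact: val_inj.
  - move=> n y hy /=; have hy' : gr_deg (n - s) (d (pre y)) by rewrite preE.
    have [z hz /fE <-] := homogeneous_lift hd hy'.
    by rewrite -[n](subrK s); apply: hf.
exists g; split => [n y hy|x].
  by apply: hg; rewrite /= addrK.
have im : d x \in in_image d by apply/in_imageP; exists x.
by have /= := gE (Image im) => ->; apply: fE; rewrite preE.
Qed.

End Extension.

(** * Connections on graded modules *)

Lemma subrDDKA (V : zmodType) (u x y z t : V) :
  (u + x + y) - (u + z + t) = (x - z) + (y - t).
Proof. by rewrite -(addrA u x) -(addrA u z) (addrC u) addrKA opprD addrACA. Qed.

Section Jet.
Variables (A : comNzRingType) (m : nat) (j : 'I_m) (M : grmod A m).
Local Notation R := {mpoly A[m]}.

(** The module of first order jets along the j-th partial derivative: linear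
    maps x |-> (x, D x) into it are exactly the connections D. In degree n
    the first coordinate has degree n + 1, so that D lowers degrees by one. *)
Definition jet : Type := (M * M)%type.
HB.instance Definition _ := GRing.Zmodule.copy jet (M * M)%type.

Definition jet_scale (a : R) (u : jet) : jet :=
  (a *: u.1, a *: u.2 + mderiv j a *: u.1).

Fact jet_scalerA a b u : jet_scale a (jet_scale b u) = jet_scale (a * b) u.
Proof.
rewrite /jet_scale /= !scalerA mderivM; congr (_, _).
rewrite scalerDr !scalerA -addrA -scalerDl; congr (_ + _ *: _).
by rewrite addrC.
Qed.
Fact jet_scale1r : left_id 1 jet_scale.
Proof.
case=> x y; rewrite /jet_scale /= !scale1r -mpolyC1 mderivC.
by rewrite scale0r addr0.
Qed.
Fact jet_scalerDr : right_distributive jet_scale +%R.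
Proof.
move=> a [x y] [z t]; rewrite /jet_scale /= !scalerDr; congr (_, _).
by rewrite /= addrACA.
Qed.
Fact jet_scalerDl u : {morph jet_scale^~ u : a b / a + b}.
Proof.
case: u => x y a b; rewrite /jet_scale /= mderivD !scalerDl; congr (_, _).
by rewrite /= addrACA.
Qed.

HB.instance Definition _ := GRing.Zmodule_isLmodule.Build R jet
  jet_scalerA jet_scale1r jet_scalerDr jet_scalerDl.

Let jet_deg (n : int) (u : jet) : Prop := gr_deg (n + 1) u.1 /\ gr_deg n u.2.

Fact jet_deg0 n : jet_deg n 0. Proof. by split; apply: gr_deg0. Qed.
Fact jet_degB n u v : jet_deg n u -> jet_deg n v -> jet_deg n (u - v).
Proof. by move=> [? ?] [? ?]; split; apply: gr_degB. Qed.
Fact jet_degZ k n a u : poly_deg k a -> jet_deg n u -> jet_deg (k + n) (a *: u).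
Proof.
move=> ha [h1 h2]; split; first by rewrite -addrA; apply: gr_degZ.
apply: gr_degD; first exact: gr_degZ.
have -> : k + n = (k - 1) + (n + 1) by rewrite addrACA addNr addr0.
by apply: gr_degZ => //; apply: poly_deg_mderiv.
Qed.
Fact jet_fst_sum (t : seq int) (f : int -> jet) :
  (\sum_(n <- t) f n).1 = \sum_(n <- t) (f n).1.
Proof. by elim: t => [|n t IH]; rewrite ?big_nil // !big_cons -IH. Qed.
Fact jet_snd_sum (t : seq int) (f : int -> jet) :
  (\sum_(n <- t) f n).2 = \sum_(n <- t) (f n).2.
Proof. by elim: t => [|n t IH]; rewrite ?big_nil // !big_cons -IH. Qed.
Fact jet_span (u : jet) : exists (t : seq int) (f : int -> jet),
  [/\ uniq t, forall n, jet_deg n (f n) & u = \sum_(n <- t) f n].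
Proof.
case: u => x y; pose sx := [seq n - 1 | n <- support_degrees x].
pose t := undup (sx ++ support_degrees y).
have ut : uniq t by apply: undup_uniq.
exists t, (fun n => (component (n + 1) x, component n y)); split => //.
  by move=> n; split; apply: component_deg.
rewrite [RHS]surjective_pairing jet_fst_sum jet_snd_sum /=; congr (_, _).
  rewrite -{1}(sum_component x).
  transitivity (\sum_(n <- sx) component (n + 1) x).
    by rewrite big_map; apply: eq_bigr => n _; rewrite subrK.
  symmetry; apply: big_support => //.
  - by rewrite map_inj_uniq ?support_degrees_uniq //; apply: addIr.
  - by move=> k hk; rewrite mem_undup mem_cat hk.
  - move=> k hk; apply: component_out; apply: contra hk => hk.
    by apply/mapP; exists (k + 1) => //; rewrite addrK.
rewrite -{1}(sum_component y); symmetry; apply: big_support => //.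
- exact: support_degrees_uniq.
- by move=> k hk; rewrite mem_undup mem_cat hk orbT.
- by move=> k /component_out.
Qed.
Fact jet_indep (t : seq int) (f : int -> jet) :
  uniq t -> (forall n, jet_deg n (f n)) -> \sum_(n <- t) f n = 0 ->
  forall n, n \in t -> f n = 0.
Proof.
move=> ut hf f0 n nt; rewrite [f n]surjective_pairing; congr (_, _).
  rewrite -[n in LHS](addrK 1).
  apply: (@gr_indep _ _ M [seq k + 1 | k <- t] (fun k => (f (k - 1)).1)).
  - by rewrite map_inj_uniq //; apply: addIr.
  - by move=> k; have [h _] := hf (k - 1); rewrite subrK in h.
  - rewrite big_map -[RHS](congr1 fst f0) jet_fst_sum.
    by apply: eq_bigr => k _; rewrite addrK.
  - by apply/mapP; exists n.
apply: (@gr_indep _ _ M t (fun k => (f k).2)) => //; first by move=> k; case: (hf k).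
by rewrite -jet_snd_sum f0.
Qed.

Definition jet_grmod : grmod A m :=
  @GrMod A m jet jet_deg jet_deg0 jet_degB jet_degZ jet_span jet_indep.

Definition jet_incl (y : M) : jet_grmod := (0, y).

Lemma jet_incl_linear : linear jet_incl.
Proof.
move=> a x y; rewrite /jet_incl; congr (_, _); first by rewrite /= scaler0 addr0.
by rewrite /= scaler0 addr0.
Qed.

HB.instance Definition _ := GRing.isLinear.Build R M jet_grmod _ jet_incl jet_incl_linear.

End Jet.

Section Connections.
Variables (A : comNzRingType) (m : nat).
Local Notation R := {mpoly A[m]}.
Implicit Types M N E : grmod A m.

Definition connection M (j : 'I_m) (D : M -> M) : Prop :=
  [/\ {morph D : x y / x + y},
      forall a x, D (a *: x) = mderiv j a *: x + a *: D x
    & forall n x, gr_deg n x -> gr_deg (n - 1) (D x)].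

Lemma connection0 M j (D : M -> M) : connection j D -> D 0 = 0.
Proof.
by case=> DD _ _; apply: (addrI (D 0)); rewrite -DD !addr0.
Qed.

(** A graded retraction g of y |-> (0, y) exists by injectivity. Since
    a (x, 0) = (a x, d_j(a) x), the map x |-> - g (x, 0) obeys the Leibniz rule. *)
Lemma connection_exists E j :
  graded_injective E -> exists D : E -> E, connection j D.
Proof.
move=> injE.
have [g [hg gE]] : exists g : {linear jet_grmod j E -> E},
    is_graded_hom g /\ forall y, g (jet_incl j y) = idfun y.
  apply: injE => //; last by move=> x y [].
  by move=> n x hx; split => //; apply: gr_deg0.
(* The horizontal lift: it is additive, and fails to be linear exactly by the
   derivative term. *)
pose hor (x : E) : jet_grmod j E := (x, 0).
exists (fun x => - g (hor x)); split.
- move=> x y; rewrite -opprD -raddfD; congr (- g _).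
  by rewrite /hor; congr (_, _); rewrite /= addr0.
- move=> a x; have -> : hor (a *: x) = a *: hor x - jet_incl j (mderiv j a *: x).
    by congr (_, _); rewrite /= ?subr0 // scaler0 add0r subrr.
  by rewrite linearB linearZ /= gE /= opprB scalerN.
- move=> n x hx; apply/gr_degN/hg; split; last exact: gr_deg0.
  by rewrite subrK.
Qed.

(** For an arbitrary connection D0 on E, the defect d D - D0 d is linear because
    the Leibniz terms cancel; extending it along d gives the correction that must
    be added to D0. *)
Lemma connection_extend M E (d : {linear M -> E}) j (D : M -> M) :
  graded_injective E -> is_graded_hom d -> connection j D ->
  (forall x, d x = 0 -> d (D x) = 0) ->
  exists2 D' : E -> E, connection j D' & forall x, D' (d x) = d (D x).
Proof.
move=> injE hd [DD DZ Ddeg] Dker.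
have [D0 cD0] := connection_exists j injE; have [D0D D0Z D0deg] := cD0.
have f_linear : linear (fun x => d (D x) - D0 (d x)).
  move=> a x y; rewrite DD DZ !linearD !linearZ /= D0D D0Z scalerN.
  exact: subrDDKA.
pose f : {linear M -> E} :=
  HB.pack (fun x => d (D x) - D0 (d x)) (GRing.isLinear.Build _ _ _ _ _ f_linear).
have [g [gdeg gE]] : exists g : {linear E -> E},
    (forall n y, gr_deg n y -> gr_deg (n - 1) (g y)) /\ forall x, g (d x) = f x.
  apply: extend_along => //.
  - move=> n x hx /=; apply: gr_degB; last exact/D0deg/hd.
    exact/hd/Ddeg.
  - by move=> x dx0 /=; rewrite dx0 (connection0 cD0) Dker // subrr.
exists (fun y => D0 y + g y); last by move=> x; rewrite gE /= addrC subrK.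
split.
- by move=> x y; rewrite D0D raddfD addrACA.
- by move=> a x; rewrite D0Z linearZ /= scalerDr addrA.
- by move=> n x hx; apply: gr_degD; [apply: D0deg | apply: gdeg].
Qed.

Lemma mderiv_connection (j : 'I_m) :
  connection (M := poly_grmod A m) j (mderiv j : R^o -> R^o).
Proof.
split; first exact: mderivD.
- by move=> a x; apply: mderivM.
- by move=> n p hp; apply: (@poly_deg_mderiv A m n j p).
Qed.

(** The degree operator is a connection over the Euler derivation of R; both
    sides are additive in a and x, which reduces this to homogeneous arguments. *)
Lemma degree_opZ M (a : R) (x : M) :
  degree_op (a *: x) = (\sum_(j < m) 'X_j * mderiv j a) *: x + a *: degree_op x.
Proof.
suff H : forall x : M, (fun a : poly_grmod A m => degree_op ((a : R) *: x)) =1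
    (fun a => (\sum_(j < m) 'X_j * mderiv j (a : R)) *: x + (a : R) *: degree_op x).
  exact: H.
move=> {a}y; apply: eq_on_homogeneous.
- by move=> a b; rewrite scalerDl degree_opD.
- move=> a b; rewrite [RHS]addrACA -!scalerDl; congr (_ *: _ + _).
  by rewrite -big_split; apply: eq_bigr => j _; rewrite mderivD mulrDr.
move=> k a ha; move: y; apply: eq_on_homogeneous.
- by move=> u v; rewrite scalerDr degree_opD.
- by move=> u v; rewrite degree_opD !scalerDr addrACA.
move=> n z hz.
rewrite (degree_op_homog hz) (euler_formula ha) (degree_op_homog (gr_degZ ha hz)).
by rewrite mulrzDr scalerMzl scalerMzr.
Qed.

Definition euler_defect M (D : 'I_m -> M -> M) (x : M) : M :=
  \sum_(j < m) 'X_j *: D j x - degree_op x.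

(** Both terms obey the Leibniz rule over the same derivation, so their
    difference is linear. *)
Lemma euler_defect_linear M (D : 'I_m -> M -> M) :
  (forall j, connection j (D j)) -> linear (euler_defect D).
Proof.
move=> cD a x y; rewrite /euler_defect degree_opD degree_opZ.
have -> : \sum_(j < m) 'X_j *: D j (a *: x + y) =
    (\sum_(j < m) 'X_j * mderiv j a) *: x + a *: (\sum_(j < m) 'X_j *: D j x)
    + \sum_(j < m) 'X_j *: D j y.
  rewrite scaler_suml scaler_sumr -!big_split; apply: eq_bigr => j _ /=.
  have [DD DZ _] := cD j.
  by rewrite DD DZ !scalerDr !scalerA [a * _]mulrC.
by rewrite subrDDKA scalerBr.
Qed.

Lemma euler_defect_graded M (D : 'I_m -> M -> M) n (x : M) :
  (forall j, connection j (D j)) -> gr_deg n x -> gr_deg n (euler_defect D x).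
Proof.
move=> cD hx; apply: gr_degB; last by rewrite (degree_op_homog hx); apply: gr_degMz.
apply: gr_deg_sum => j _; rewrite -[n](subrK 1); apply: gr_degXl.
by have [_ _] := cD j; apply.
Qed.

Lemma euler_defect_hom M N (f : {linear M -> N})
    (D : 'I_m -> M -> M) (D' : 'I_m -> N -> N) x :
  is_graded_hom f -> (forall j x, D' j (f x) = f (D j x)) ->
  euler_defect D' (f x) = f (euler_defect D x).
Proof.
move=> hf D'E; rewrite /euler_defect (degree_op_hom x hf) linearB.
by congr (_ - _); rewrite linear_sum; apply: eq_bigr => j _; rewrite D'E linearZ.
Qed.

End Connections.

(** * Torsion with respect to powers of an ideal *)

Section IdealPowers.
Variables (B : comNzRingType) (I : B -> Prop).
Hypothesis idI : is_ideal I.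

Lemma ideal_sum (J : B -> Prop) (T : eqType) (s : seq T) (F : T -> B) :
  is_ideal J -> (forall t, t \in s -> J (F t)) -> J (\sum_(t <- s) F t).
Proof.
move=> [J0 JD _] h; rewrite big_seq; elim/big_ind: _ => //.
Qed.

Lemma ideal_pow_ideal k : is_ideal (ideal_pow I k).
Proof.
case: k => [|k]; first by split.
have [_ _ IM] := idI; split.
- by exists [::]; split => //; rewrite big_nil.
- move=> _ _ [s [hs ->]] [t [ht ->]]; exists (s ++ t); rewrite big_cat; split => // u.
  by rewrite mem_cat => /orP[/hs|/ht].
- move=> a _ [s [hs ->]]; exists [seq (a * u.1, u.2) | u <- s]; split.
    by move=> _ /mapP[u /hs[h1 h2] ->]; split => //; apply: IM.
  by rewrite big_map mulr_sumr; apply: eq_bigr => u _; rewrite mulrA.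
Qed.

Lemma ideal_powS k x : ideal_pow I k.+1 x -> ideal_pow I k x.
Proof.
move=> [s [hs ->]]; apply: ideal_sum; first exact: ideal_pow_ideal.
by move=> u /hs[_ h]; have [_ _] := ideal_pow_ideal k; apply.
Qed.

Lemma ideal_pow_le j k x : (j <= k)%N -> ideal_pow I k x -> ideal_pow I j x.
Proof.
move=> /subnK <-; elim: (k - j)%N => [|l IH] //.
by rewrite addSn => /ideal_powS.
Qed.

Lemma ideal_pow_derivation (D : B -> B) k x :
  {morph D : a b / a + b} -> (forall a b, D (a * b) = D a * b + a * D b) ->
  ideal_pow I k.+1 x -> ideal_pow I k (D x).
Proof.
move=> DD DM; have D0 : D 0 = 0 by apply: (addrI (D 0)); rewrite -DD !addr0.
elim: k x => [|k IH] _ [s [hs ->]] //.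
rewrite (big_morph D DD D0); apply: ideal_sum; first exact: ideal_pow_ideal.
move=> u /hs[h1 h2]; have [_ KD KM] := ideal_pow_ideal k.+1.
rewrite DM; apply: KD; first exact: KM.
exists [:: (u.1, D u.2)]; rewrite big_seq1; split => // v.
by rewrite inE => /eqP -> /=; split => //; apply: IH.
Qed.

End IdealPowers.

Section Torsion.
Variables (A : comNzRingType) (m : nat) (I : {mpoly A[m]} -> Prop).
Hypothesis idI : is_ideal I.
Implicit Types M N : grmod A m.

Lemma torsionD M (x y : M) : in_torsion I x -> in_torsion I y -> in_torsion I (x + y).
Proof.
move=> [k hk] [l hl]; exists (maxn k l) => a ha.
by rewrite scalerDr hk ?hl ?addr0 //; apply: ideal_pow_le ha; rewrite ?leq_maxl ?leq_maxr.
Qed.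

Lemma torsionZ M a (x : M) : in_torsion I x -> in_torsion I (a *: x).
Proof.
by move=> [k hk]; exists k => b hb; rewrite scalerA mulrC -scalerA hk ?scaler0.
Qed.

Lemma torsion_hom M N (f : {linear M -> N}) x : in_torsion I x -> in_torsion I (f x).
Proof. by move=> [k hk]; exists k => a ha; rewrite -linearZ /= hk ?raddf0. Qed.

(** If I^k kills x then I^(k+1) kills D x, since a (D x) = D (a x) - d_j(a) x
    and d_j maps I^(k+1) into I^k. *)
Lemma torsion_connection M j (D : M -> M) x :
  connection j D -> in_torsion I x -> in_torsion I (D x).
Proof.
move=> cD [k hk]; have [_ DZ _] := cD; exists k.+1 => a ha.
have hda : ideal_pow I k (mderiv j a).
  by apply: ideal_pow_derivation ha => //; [apply: mderivD | apply: mderivM].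
have := DZ a x; rewrite (hk _ hda) (hk _ (ideal_powS idI ha)) (connection0 cD).
by rewrite add0r.
Qed.

End Torsion.

(** * Compatible connections on an injective resolution *)

Section Resolution.
Variables (A : comNzRingType) (m : nat) (I : {mpoly A[m]} -> Prop).
Hypothesis idI : is_ideal I.
Local Notation R := {mpoly A[m]}.
Variable E : graded_injective_resolution (poly_grmod A m).

Lemma coboundaryD i (x y : E i) :
  is_coboundary I x -> is_coboundary I y -> is_coboundary I (x + y).
Proof.
case: i x y => [|i] x y /=; first by move=> -> ->; rewrite addr0.
move=> [a [ta <-]] [b [tb <-]]; exists (a + b); split; first exact: torsionD.
exact: raddfD.
Qed.

Lemma coboundaryZ i a (x : E i) : is_coboundary I x -> is_coboundary I (a *: x).
Proof.
case: i x => [|i] x /=; first by move=> ->; rewrite scaler0.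
move=> [y [ty <-]]; exists (a *: y); split; first exact: torsionZ.
exact: linearZ.
Qed.

Lemma coboundary0 i : is_coboundary I (0 : E i).
Proof.
case: i => [|i] //=; exists 0; rewrite raddf0; split => //.
by exists 0%N => a _; rewrite scaler0.
Qed.

Lemma coboundaryB i (x y : E i) :
  is_coboundary I x -> is_coboundary I y -> is_coboundary I (x - y).
Proof.
by move=> hx hy; apply: coboundaryD; rewrite // -scaleN1r; apply: coboundaryZ.
Qed.

Lemma coboundary_sum i (T : finType) (F : T -> E i) :
  (forall t, is_coboundary I (F t)) -> is_coboundary I (\sum_t F t).
Proof.
by move=> h; elim/big_ind: _ => //; [exact: coboundary0 | exact: coboundaryD].
Qed.

(** The invariant of the induction along the resolution. The map w stands for
    d u, where u is the homotopy found one step earlier; only its consequences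
    are recorded, so that the statement mentions a single degree i. On cocycles
    the Euler defect is then the coboundary d u. *)
Definition euler_structure i (D : 'I_m -> E i -> E i) (w : {linear E i -> E i}) : Prop :=
  [/\ forall j, connection j (D j),
      forall j x, ir_d E i x = 0 -> ir_d E i (D j x) = 0,
      forall j x, is_coboundary I x -> is_coboundary I (D j x),
      [/\ is_graded_hom w, forall x, ir_d E i (w x) = 0
        & forall x, in_torsion I x -> is_coboundary I (w x)]
    & forall x, ir_d E i x = 0 -> euler_defect D x = w x].

(** On R itself the connections are the partial derivatives, and the Euler defect
    vanishes by Euler's formula, so the homotopy starts with w = 0. *)
Lemma euler_structure0 : exists D w, @euler_structure 0 D w.
Proof.
have extend j : exists Dj : E 0 -> E 0, connection j Dj /\
    forall p, Dj (ir_aug E p) = ir_aug E (mderiv j p : R^o).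
  have [||||D' cD' D'E] := @connection_extend _ _ _ _ (ir_aug E) j (mderiv j : R^o -> R^o).
  - exact: ir_injective.
  - exact: ir_aug_graded.
  - exact: mderiv_connection.
  - move=> p; rewrite -[in X in X -> _](raddf0 (ir_aug E)) => /ir_aug_inj ->.
    by rewrite mderiv0 raddf0.
  - by exists D'.
have [D hD] := fin_all_exists extend.
exists D, \0; split.
- by move=> j; case: (hD j).
- move=> j x /ir_exact0[p <-]; have [_ ->] := hD j.
  by apply/ir_exact0; exists (mderiv j p : R^o).
- by move=> j x /= ->; have [/connection0 ->] := hD j.
- split => [n x _|x|x _] /=; [exact: gr_deg0|exact: raddf0|by []].
move=> x /ir_exact0[p <-].
rewrite (@euler_defect_hom _ _ (poly_grmod A m) _ _ 
  (fun j => mderiv j : R^o -> R^o)); first last.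
- by move=> j y; case: (hD j).
- exact: ir_aug_graded.
suff -> : euler_defect (M := poly_grmod A m) (fun j => mderiv j : R^o -> R^o) p = 0.
  exact: raddf0.
move: p; apply: (@eq_on_homogeneous _ _ (poly_grmod A m) _ _ (fun=> 0)).
- move=> x' y.
  have := @euler_defect_linear _ _ (poly_grmod A m) _ (@mderiv_connection A m) 1 x' y.
  by rewrite !scale1r.
- by move=> *; rewrite addr0.
move=> n p hp; apply/eqP; rewrite subr_eq0 (degree_op_homog hp); apply/eqP.
exact: euler_formula.
Qed.

(** The map theta - w vanishes on ker d, hence equals h d for some linear h; the
    next w is d h. On a cocycle x = d y one has
    theta (d y) - d h (d y) = d (theta y) - d (theta y - w y) = d (w y) = 0. *)
Lemma euler_structureS i D w :
  @euler_structure i D w -> exists D' w', @euler_structure i.+1 D' w'.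
Proof.
move=> [cD Dker Dcob [wdeg dw wtor] Dw].
have dd y : ir_d E i.+1 (ir_d E i y) = 0 by apply/ir_exact; exists y.
have extend j : exists Dj : E i.+1 -> E i.+1, connection j Dj /\
    forall x, Dj (ir_d E i x) = ir_d E i (D j x).
  have [||||D' cD' D'E] := @connection_extend _ _ _ _ (ir_d E i) j (D j) => //.
  - exact: ir_injective.
  - exact: ir_d_graded.
  - by move=> x; apply: Dker.
  - by exists D'.
have [D' hD'] := fin_all_exists extend.
have f_linear : linear (fun x => euler_defect D x - w x).
  move=> a x y; rewrite euler_defect_linear // linearP /= scalerBr opprD addrACA //.
pose f : {linear E i -> E i} :=
  HB.pack (fun x => euler_defect D x - w x) (GRing.isLinear.Build _ _ _ _ _ f_linear).
have [h [hdeg hE]] : exists h : {linear E i.+1 -> E i},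
    (forall n y, gr_deg n y -> gr_deg (n + 0) (h y)) /\ forall x, h (ir_d E i x) = f x.
  apply: extend_along.
  - exact: ir_injective.
  - exact: ir_d_graded.
  - move=> n x hx; rewrite addr0; apply: gr_degB; last exact: wdeg.
    exact: euler_defect_graded.
  - by move=> x dx /=; rewrite Dw // subrr.
exists D', (ir_d E i \o h); split.
- by move=> j; case: (hD' j).
- move=> j x /ir_exact[y <-]; have [_ ->] := hD' j; exact: dd.
- move=> j x /= [y [ty <-]]; have [_ ->] := hD' j.
  by exists (D j y); split => //; apply: torsion_connection ty.
- split => [n x hx|x|x tx] /=; last by exists (h x); split => //; apply: torsion_hom.
    by apply: ir_d_graded; have := hdeg _ _ hx; rewrite addr0.
  exact: dd.
move=> x /ir_exact[y <-].
rewrite (@euler_defect_hom _ _ _ _ _ D); first last.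
- by move=> j z; case: (hD' j).
- exact: ir_d_graded.
by rewrite /= hE /= [RHS]linearB dw subr0.
Qed.

Lemma euler_structure_exists i : exists D w, @euler_structure i D w.
Proof.
by elim: i => [|i [D [w /euler_structureS]]] //; apply: euler_structure0.
Qed.

End Resolution.

(** * Propagation of vanishing *)

Section Vanishing.
Variables (A : comNzRingType) (m : nat) (I : {mpoly A[m]} -> Prop).
Hypothesis idI : is_ideal I.
Hypothesis charA : contains_field_char0 A.
Local Notation R := {mpoly A[m]}.

Lemma int_unit (k : int) : k != 0 -> exists u : R, u * k%:~R = 1.
Proof.
case: charA => K [f [/pcharf0P chK _]] k0.
have kK : (k%:~R : K) != 0.
  by case: k k0 => k; rewrite ?NegzE ?mulrNz ?oppr_eq0 -?pmulrn chK.
exists ((f (k%:~R)^-1)%:MP).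
have -> : k%:~R = (f k%:~R)%:MP :> R by rewrite rmorph_int rmorph_int.
by rewrite -mpolyCM -rmorphM mulVf ?rmorph1.
Qed.

Lemma mderiv_var (j : 'I_m) : mderiv j 'X_j = 1 :> R.
Proof.
rewrite mderivX mnm1E eqxx scale1r -mpolyX0; congr mpolyX.
by apply/mnmP => k; rewrite !mnmE subnn.
Qed.

Lemma mulrz_eq0 (M : grmod A m) (x : M) (k : int) : k != 0 -> x *~ k = 0 -> x = 0.
Proof.
move=> /int_unit[u uk] xk; rewrite -[x]scale1r -uk -scalerA.
by rewrite -scalerMzl scale1r xk scaler0.
Qed.

(** Both claims follow from Euler's formula on M, read on cocycles modulo
    coboundaries of I-torsion elements. *)
Lemma component_vanishing (i : nat) (M : grmod A m) :
  is_local_cohomology I i (poly_grmod A m) M ->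
  (forall n : int, 0 <= n -> ~ component_nonzero M n -> ~ component_nonzero M (n + 1))
  /\ (forall n : int, n <= - m%:Z -> ~ component_nonzero M n ->
        ~ component_nonzero M (n - 1)).
Proof.
move=> [E [Z [iota [pi [[iota_deg iota_inj] cocycleE pi_deg pi_surj pi_ker]]]]].
have [D [w [cD Dker Dcob [wdeg dw wtor] Dw]]] := euler_structure_exists idI E i.
have iota_reflects n z : gr_deg n (iota z) -> gr_deg n z.
  by move=> /(homogeneous_lift iota_deg)[y hy /iota_inj <-].
have vanish n z : ~ component_nonzero M n -> gr_deg n (iota z) ->
    is_coboundary I (iota z).
  move=> M0 /iota_reflects hz; apply/pi_ker; apply: NNPP => piz.
  by apply: M0; exists (pi z); split => //; apply: pi_deg.
have lift n (y : M) : gr_deg n y ->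
    exists2 z, gr_deg n (iota z) & pi z = y.
  have [z <-] := pi_surj y => /(homogeneous_lift pi_deg)[z' hz' <-].
  by exists z' => //; apply: iota_deg.
have cocycle z : in_torsion I (iota z) /\ ir_d E i (iota z) = 0.
  by apply/cocycleE; exists z.
have kill n (k : int) z : k != 0 -> gr_deg n (iota z) ->
    is_coboundary I (iota z *~ k) -> pi z = 0.
  by rewrite -raddfMz => k0 hz /pi_ker; rewrite raddfMz => /(mulrz_eq0 k0).
have euler n z : gr_deg n (iota z) ->
    \sum_(j < m) 'X_j *: D j (iota z) = iota z *~ n + w (iota z).
  move=> hz; have [_ dz] := cocycle z.
  by rewrite -(Dw _ dz) /euler_defect (degree_op_homog hz) addrC subrK.
have wcob z : is_coboundary I (w (iota z)) by apply: wtor; case: (cocycle z).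
split=> n hn M0 [y [hy yn0]]; apply: yn0.
  have [z hz <-] := lift _ _ hy.
  apply: (kill (n + 1) (n + 1)) => //; first by rewrite gt_eqF // ltzD1.
  rewrite -[_ *~ _](addrK (w (iota z))) -euler //.
  apply: coboundaryB => //; apply: coboundary_sum => // j; apply: coboundaryZ => //.
  have [tz dz] := cocycle z.
  have [z' z'E] : exists z', iota z' = D j (iota z).
    by apply/cocycleE; split; [apply: torsion_connection tz | apply: Dker].
  rewrite -z'E; apply: vanish M0 _; rewrite z'E -[n](addrK 1).
  by have [_ _] := cD j; apply.
have [z hz <-] := lift _ _ hy.
apply: (kill (n - 1) (n - 1 + m%:Z)) => //.
  by rewrite lt_eqF // addrAC subr_lt0 (@le_lt_trans _ _ 0) // -lerBrDr sub0r.
have -> : iota z *~ (n - 1 + m%:Z) = \sum_(j < m) D j ('X_j *: iota z) - w (iota z).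
  have -> : \sum_(j < m) D j ('X_j *: iota z) =
      \sum_(j < m) iota z + \sum_(j < m) 'X_j *: D j (iota z).
    rewrite -big_split; apply: eq_bigr => j _ /=; have [_ -> _] := cD j.
    by rewrite mderiv_var scale1r.
  by rewrite (euler _ _ hz) sumr_const card_ord addrA addrK addrC mulrzDr.
apply: coboundaryB => //; apply: coboundary_sum => // j; apply: Dcob.
rewrite -linearZ; apply: vanish M0 _; rewrite linearZ -[n](subrK 1).
exact: gr_degXl.
Qed.

End Vanishing.

(** A failure of P at some n <= a would spread to all smaller integers, leaving
    only the finitely many l with n < l < 0. *)
Lemma infinitely_many_below (P : int -> Prop) (a : int) :
  (forall n, n <= a -> ~ P n -> ~ P (n - 1)) ->
  infinitely_many (fun n => n < 0 /\ P n) -> forall n, n <= a -> P n.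
Proof.
move=> step inf n na; apply: NNPP => Pn.
have below (k : nat) : ~ P (n - k%:Z).
  elim: k => [|k IH]; first by rewrite subr0.
  rewrite -addn1 PoszD opprD addrA; apply: step => //.
  by apply: le_trans na; rewrite gerBl.
have [l [+ [l0 Pl]]] := inf [seq - k%:Z | k <- iota 0 `|n|.+1].
case: (lerP l n) => [ln _|nl]; last first.
  (* The exceptional list [0; -1; ..; -|n|] contains every l with n < l < 0. *)
  case/negP; apply/mapP; exists `|l|%N; last by rewrite ltz0_abs ?opprK.
  by rewrite mem_iota /= add0n ltnS -lez_nat !ltz0_abs ?lerN2 ?(ltW nl) // (lt_trans nl).
by apply: (below `|n - l|%N); rewrite gez0_abs ?subr_ge0 // opprB addrC subrK.
Qed.

Lemma infinitely_many_opp (P : int -> Prop) :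
  infinitely_many P -> infinitely_many (fun n => P (- n)).
Proof.
move=> inf s; have [n [ns Pn]] := inf [seq - k | k <- s].
exists (- n); rewrite opprK; split => //; apply: contra ns => ns.
by apply/mapP; exists (- n); rewrite ?opprK.
Qed.

Lemma infinitely_many_above (P : int -> Prop) (a : int) :
  (forall n, a <= n -> ~ P n -> ~ P (n + 1)) ->
  infinitely_many (fun n => 0 < n /\ P n) -> forall n, a <= n -> P n.
Proof.
move=> step /infinitely_many_opp inf n an; rewrite -[n]opprK.
apply: (@infinitely_many_below (fun k => P (- k)) (- a)); last by rewrite lerN2.
  by move=> k ka; rewrite opprB addrC; apply: step; rewrite lerNr.
by move=> s; have [k [ks [k0 Pk]]] := inf s; exists k; rewrite -oppr_gt0.
Qed.

Lemma infinitely_many_nat (P : int -> Prop) (f : nat -> int) :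
  injective f -> (forall k, P (f k)) -> infinitely_many P.
Proof.
move=> f_inj Pf s; apply: NNPP => none.
have sub : {subset [seq f k | k <- iota 0 (size s).+1] <= s}.
  move=> _ /mapP[k _ ->]; apply/negPn/negP => ks.
  by apply: none; exists (f k).
have := uniq_leq_size _ sub; rewrite map_inj_uniq ?iota_uniq // => /(_ isT).
by rewrite size_map size_iota ltnn.
Qed.

Theorem theorem1p3 (A : comNzRingType) (m : nat) (I : {mpoly A[m]} -> Prop)
    (i : nat) (M : grmod A m) :
  regular_ring A -> contains_field_char0 A -> (1 <= m)%N ->
  homogeneous_ideal I ->
  is_local_cohomology I i (poly_grmod A m) M ->
  (infinitely_many (fun n : int => n < 0 /\ component_nonzero M n) <->
   (forall n : int, n <= - (m%:Z) -> component_nonzero M n))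
  /\
  (infinitely_many (fun n : int => 0 < n /\ component_nonzero M n) <->
   (forall n : int, 0 <= n -> component_nonzero M n)).
Proof.
move=> _ charA m_gt0 [idI _] /(component_vanishing idI charA)[up down].
split; split.
- exact: infinitely_many_below.
- move=> nz; apply: (@infinitely_many_nat _ (fun k => - (m + k)%:Z)).
    by move=> k l /oppr_inj[] /addnI.
  move=> k; split; first by rewrite oppr_lt0 ltz_nat addn_gt0 m_gt0.
  by apply: nz; rewrite lerN2 lez_nat leq_addr.
- exact: infinitely_many_above.
- move=> nz; apply: (@infinitely_many_nat _ (fun k => k.+1%:Z)).
    by move=> k l [].
  by move=> k; split => //; apply: nz.
Qed.
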